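(* Let $\mathbb{F}$ be $\mathbb{R}$ or $\mathbb{C}$, let $n\in\mathbb{N}$ and $V=\mathbb{F}^n$, let $A$ be a linear involution of order $2$ on $\mathbb{F}^n$, and let $\Omega\subset\mathbb{F}^n$ be a connected open set with $A(\Omega)=\Omega$. Let $m$ be a nonnegative integer, let $\omega^j_k\in V^{\odot k}$ for $j=0,1$ and $k=0,\dots,m$, and let $$L=\sum_{j=0}^{1}\sum_{k=0}^m(A^* )^jD^k_{\omega^j_k}.$$ Define $$R=\sum_{j=0}^{1}\sum_{k=0}^m(A^* )^jD^k_{\xi^j_k},\qquad \xi^0_k=-A\omega^0_k,\quad \xi^1_k=\omega^1_k,\quad k=0,1,\dots,m.$$ Then $RL\in \operatorname{PD}_n[\mathbb{F}]$, that is, $RL$ is a linear partial differential operator with constant coefficients not involving $A^*$. Furthermore, $L$ and $R$ commute: $RL=LR$.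
   Context: A map $A$ is an involution of order $2$ if $A^2=\mathrm{Id}$ and $A\neq\mathrm{Id}$. For $k\ge 2$, $V^{\odot k}$ denotes the space of symmetric tensors of order $k$ over $V=\mathbb{F}^n$ (with symmetric product $\odot$); $V^{\odot 1}=V$ and $V^{\odot 0}=\mathbb{F}$. For $v=(v_1,\dots,v_n)\in V$ and $y\in\mathcal{C}^1(\Omega,\mathbb{F})$, the directional derivative is $D_v y=v_1\frac{\partial y}{\partial x^1}+\cdots+v_n\frac{\partial y}{\partial x^n}$ (partial derivatives with respect to the coordinates of $\mathbb{F}^n$; for $\mathbb{F}=\mathbb{C}$ these are complex derivatives). For $k\ge 1$ and $\omega\in V^{\odot k}$, the operator $D^k_\omega$ is determined by linearity in $\omega$ and $D^k_{v_1\odot\cdots\odot v_k}=D_{v_1}\circ\cdots\circ D_{v_k}$; for $\omega\in V^{\odot 0}=\mathbb{F}$, $D^0_{\omega}y=\omega y$. Thus $D^p_{\omega_2}\circ D^q_{\omega_1}=D^{p+q}_{\omega_2\odot\omega_1}$. The linear map $A$ acts on $V^{\odot k}$ linearly by $A(v_1\odot\cdots\odot v_k)=Av_1\odot\cdots\odot Av_k$, and as the identity on $V^{\odot 0}=\mathbb{F}$. The pullback operator $A^*$ is $(A^*y)(x)=y(Ax)$ for functions $y:\Omega\to\mathbb{F}$, with $(A^* )^0=\mathrm{Id}$. $\operatorname{PD}_n[\mathbb{F}]$ denotes the algebra of linear partial differential operators in $n$ variables with constant coefficients in $\mathbb{F}$, i.e. finite sums $\sum_k D^k_{\omega_k}$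 with $\omega_k\in V^{\odot k}$. It is identified with the symmetric tensor algebra $S^*V=\bigoplus_{k\ge0}V^{\odot k}$. Operators of the form of $L$ and $R$ are identified with elements $\left(\sum_k\omega^0_k,\sum_k\omega^1_k\right)$ of $(S^*V)^2$, and $\operatorname{PD}_n[\mathbb{F}]$ with the elements whose second component is zero. Products of operators are compositions, acting on sufficiently differentiable functions on $\Omega$ (e.g. of class $\mathcal{C}^{2m}$). *)

(* Defs.v *)
From HB Require Import structures.
From mathcomp Require Import all_boot all_order all_algebra.
From mathcomp Require Import complex.
From mathcomp Require Import all_classical all_reals all_analysis.

Set Implicit Arguments.
Unset Strict Implicit.
Unset Printing Implicit Defensive.

Import Order.TTheory GRing.Theory Num.Theory.
Import numFieldNormedType.Exports.

Local Open Scope classical_set_scope.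
Local Open Scope ring_scope.

(* Everything is over an arbitrary [F : numFieldType], with its own topology
   and with derivatives taken along increments in [F]; for [F := R[i]] these
   are therefore complex derivatives. *)

(* A tensor of order k over F^n is given by its components in the basis
   e_{I_1} (x) ... (x) e_{I_k}.  For k = 0 the only index is [tuple] of size 0,
   so that tensors of order 0 are scalars. *)
Notation tensor F n k := {ffun k.-tuple 'I_n -> F}.

Definition symmetric_tensor (F : numFieldType) (n k : nat)
    (w : tensor F n k) : Prop :=
  forall I J : k.-tuple 'I_n, perm_eq I J -> w I = w J.

(* A (v_1 (x) ... (x) v_k) = A v_1 (x) ... (x) A v_k, extended linearly:
   [A (delta_mx 0 j) 0 i] is the (i, j) entry of the matrix of A. *)
Definition tensor_act (F : numFieldType) (n : nat)
    (A : {linear 'rV[F]_n -> 'rV[F]_n}) (k : nat) (w : tensor F n k) :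
    tensor F n k :=
  [ffun I : k.-tuple 'I_n => \sum_(J : k.-tuple 'I_n)
     (\prod_(l < k) A (delta_mx 0 (tnth J l)) 0 (tnth I l)) * w J].

Definition partial_along (F : numFieldType) (n : nat) (s : seq 'I_n)
    (y : 'rV[F]_n -> F) : 'rV[F]_n -> F :=
  foldr (fun (i : 'I_n) (z : 'rV[F]_n -> F) => 'D_(delta_mx 0 i) z) y s.

(* A symmetric w is the sum over I of w_I e_{I_1} (.) ... (.) e_{I_k}, where
   (.) is the symmetric product; hence, by linearity, D^k_w is the sum over I
   of w_I d_{I_1} ... d_{I_k}. *)
Definition tensor_diff (F : numFieldType) (n k : nat) (w : tensor F n k)
    (y : 'rV[F]_n -> F) : 'rV[F]_n -> F :=
  fun x => \sum_(I : k.-tuple 'I_n) w I * partial_along I y x.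

Definition pullback (F : numFieldType) (n : nat)
    (A : 'rV[F]_n -> 'rV[F]_n) (y : 'rV[F]_n -> F) : 'rV[F]_n -> F :=
  fun x => y (A x).

(* Functions on an open Omega are total functions of which only the values on
   Omega matter: C^k is required on Omega only, and operators are compared at
   points of Omega only.  C^(k+1) on Omega means (Frechet) differentiable at
   every point of Omega, with partial derivatives of class C^k on Omega. *)
Fixpoint Ck_on (F : numFieldType) (n : nat) (Omega : set 'rV[F]_n) (k : nat)
    (y : 'rV[F]_n -> F) : Prop :=
  match k with
  | 0 => forall x, Omega x -> y z @[z --> x] --> y x
  | k'.+1 => (forall x, Omega x -> differentiable y x) /\
      (forall i : 'I_n, Ck_on Omega k' ('D_(delta_mx 0 i) y))
  end.

(* The sum over j < 2 and k <= m of (A^* )^j D^k_(w^j_k). *)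
Definition inv_op (F : numFieldType) (n : nat)
    (A : 'rV[F]_n -> 'rV[F]_n) (m : nat)
    (w : forall (j : 'I_2) (k : 'I_m.+1), tensor F n k)
    (y : 'rV[F]_n -> F) : 'rV[F]_n -> F :=
  fun x => \sum_(j < 2) \sum_(k < m.+1)
    iter j (pullback A) (tensor_diff (w j k) y) x.

(* T acts, on functions of class C^r on Omega, as an element of PD_n[F] of
   order at most r. *)
Definition PD_on (F : numFieldType) (n : nat) (Omega : set 'rV[F]_n) (r : nat)
    (T : ('rV[F]_n -> F) -> 'rV[F]_n -> F) : Prop :=
  exists zeta : forall k : 'I_r.+1, tensor F n k,
    (forall k, symmetric_tensor (zeta k)) /\
    (forall y, Ck_on Omega r y -> forall x, Omega x ->
       T y x = \sum_(k < r.+1) tensor_diff (zeta k) y x).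

(* Main.v *)
Require Import Defs.
From HB Require Import structures.
From mathcomp Require Import all_boot all_order all_algebra.
From mathcomp Require Import complex.
From mathcomp Require Import all_classical all_reals all_analysis.

Set Implicit Arguments.
Unset Strict Implicit.
Unset Printing Implicit Defensive.

Import Order.TTheory GRing.Theory Num.Theory.
Import numFieldNormedType.Exports.

Local Open Scope classical_set_scope.
Local Open Scope complex_scope.
Local Open Scope ring_scope.

(** Write [P_j] for the operator with tensors [omega^j_k] and [A P] for the
    operator whose tensors are the images under [A] of those of [P], so that
    [L = P_0 + A^* P_1] and [R = - A P_0 + A^* P_1].  Two rules govern the
    product: constant-coefficient operators commute, and passing one across
    the pullback twists it, [P A^* = A^* (A P)].  As [A] is an involution,
    [A (A P) = P] and [A^* A^* = 1], hence
      [R L = - (A P_0) P_0 + (A P_1) P_1 + A^* (P_1 P_0 - P_0 P_1)],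
    and commutativity kills the part with [A^*].  In
      [L R = - P_0 (A P_0) + (A P_1) P_1 + A^* ((A P_0) P_1 - P_1 (A P_0))]
    the same cancellation occurs and what remains is the same operator.

    The analytic content is in the two rules.  The twist rule
    ([partial_along_pullback]) is the chain rule for a linear map.  Commutation
    ([partial_along_perm]) is the symmetry of mixed partial derivatives
    ([derive_swap]), which has to hold for complex derivatives too: it is
    reduced to a real statement by restricting to the real plane spanned by
    two directions and composing with the real or the imaginary part; there,
    two applications of the mean value theorem to a second difference express
    it through either mixed derivative at a nearby point.

    Since all identities hold on [Omega] only, an operator may be applied to
    the two sides of an identity because [Omega] is open, and the classes
    [C^k] have to be closed under the operations involved.  The form required
    of a constant-coefficient operator, with symmetric tensors, is reached by
    spreading the coefficient of each monomial evenly over the reorderings of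
    its indices ([PD_on_monomial]). *)

(** * Symmetry of mixed derivatives over the reals and the complex numbers *)

(** Throughout this part, [iota] is the inclusion of the real
    scalars and [rho] a real coordinate of [F] (the identity, or the real or
    imaginary part).  The difference quotient along real increments is a
    restriction of the one along increments in [F], and [rho] commutes with
    division by a real number. *)
Lemma is_derive_along (R : realType) (F : numFieldType)
    (iota : {rmorphism R -> F}) (rho : {additive F -> R})
    (iota_cont : continuous iota) (rho_cont : continuous rho)
    (rhoZ : forall r z, rho (iota r * z) = r * rho z)
    (n : nat) (y : 'rV[F]_n -> F) (a e : 'rV[F]_n) (s : R) :
  derivable y (a + iota s *: e) e ->
  is_derive s 1 (fun t : R => rho (y (a + iota t *: e)))
    (rho ('D_e y (a + iota s *: e))).
Proof.
move=> dy.
have iota0 : iota @ 0^' --> (0 : F)^'.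
  move=> U; rewrite /dnbhs !nbhs_simpl /within /= => HU.
  have : nbhs (iota (0 : R)) (fun z => z != 0 -> U z) by rewrite rmorph0.
  move=> /iota_cont; rewrite nbhs_simpl /=.
  by apply: filterS => r /= Ur r0; apply: Ur; rewrite fmorph_eq0.
have quotient : (fun h : R => h^-1 *:
    (((fun t : R => rho (y (a + iota t *: e))) \o shift s) (h *: 1)
      - rho (y (a + iota s *: e)))) @ 0^' -->
    rho ('D_e y (a + iota s *: e)).
  have := cvg_comp _ _ (cvg_comp _ _ iota0 dy) (@rho_cont _).
  apply: cvg_trans; apply: near_eq_cvg; near=> h => /=.
  rewrite -fmorphV [LHS]rhoZ raddfB; congr (_ * (rho (y _) - _)).
  by rewrite /= [_%:A]mulr1 rmorphD scalerDl addrCA.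
split; first by apply/cvg_ex; eexists; exact: quotient.
exact: cvg_lim quotient.
Unshelve. all: by end_near. Qed.

(** The mean value theorem fails for complex values, so it is stated after
    [rho]. *)
Lemma mean_value_along (R : realType) (F : numFieldType)
    (iota : {rmorphism R -> F}) (rho : {additive F -> R})
    (iota_cont : continuous iota) (rho_cont : continuous rho)
    (rhoZ : forall r z, rho (iota r * z) = r * rho z)
    (n : nat) (y : 'rV[F]_n -> F) (a e : 'rV[F]_n) (h : R) :
  0 <= h ->
  (forall s : R, s \in `[0, h] -> derivable y (a + iota s *: e) e) ->
  exists2 s : R, s \in `[0, h] &
    rho (y (a + iota h *: e) - y a) = h * rho ('D_e y (a + iota s *: e)).
Proof.
move=> h0 dy.
pose phi (t : R) := rho (y (a + iota t *: e)).
pose dphi (t : R) := rho ('D_e y (a + iota t *: e)).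
have dphiP (s : R) : s \in `[0, h] -> is_derive s 1 phi (dphi s).
  by move=> sI; exact: (is_derive_along iota_cont rho_cont rhoZ (dy s sI)).
have dphi_oo (s : R) : s \in `]0, h[%R -> is_derive s 1 phi (dphi s).
  rewrite in_itv /= => /andP[/ltW s0 /ltW sh].
  by apply: dphiP; rewrite in_itv /= s0.
have phi_cont : {within `[0, h], continuous phi}.
  by apply: derivable_within_continuous => s /dphiP[].
have [s sI] := MVT_segment h0 dphi_oo phi_cont.
rewrite /phi /dphi rmorph0 scale0r addr0 subr0 mulrC => mv.
by exists s => //; rewrite raddfB.
Qed.

(** Shared by the next two lemmas: the quotients agree as functions of the
    increment, not only in the limit. *)
Lemma growth_rate_translate (F : numFieldType) (n : nat) (y : 'rV[F]_n -> F)
    (a b e : 'rV[F]_n) :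
  (fun h : F =>
     h^-1 *: (((fun z => y (z + b)) \o shift a) (h *: e) - y (a + b)))
  = (fun h : F => h^-1 *: ((y \o shift (a + b)) (h *: e) - y (a + b))).
Proof. by apply/funext => h /=; rewrite addrA. Qed.

Lemma derivable_translate (F : numFieldType) (n : nat) (y : 'rV[F]_n -> F)
    (a b e : 'rV[F]_n) :
  derivable (fun z => y (z + b)) a e = derivable y (a + b) e.
Proof.
by rewrite /derivable -growth_rate_translate.
Qed.

Lemma derive_translate (F : numFieldType) (n : nat) (y : 'rV[F]_n -> F)
    (a b e : 'rV[F]_n) :
  'D_e (fun z => y (z + b)) a = 'D_e y (a + b).
Proof.
by rewrite /derive -growth_rate_translate.
Qed.

(** The mean value theorem along [e], applied to the increment of [y] in the
    direction [e'], then along [e'].  The intermediate point is only known to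
    lie in [U], so that the lemma can be used again with [e] and [e'] exchanged
    while the points stay in the same set. *)
Lemma second_difference (R : realType) (F : numFieldType)
    (iota : {rmorphism R -> F}) (rho : {additive F -> R})
    (iota_cont : continuous iota) (rho_cont : continuous rho)
    (rhoZ : forall r z, rho (iota r * z) = r * rho z)
    (n : nat) (y : 'rV[F]_n -> F) (U : set 'rV[F]_n) (x e e' : 'rV[F]_n)
    (h : R) :
  0 <= h ->
  (forall s t : R, s \in `[0, h] -> t \in `[0, h] ->
     U (x + iota s *: e + iota t *: e')) ->
  (forall z, U z -> derivable y z e /\ derivable ('D_e y) z e') ->
  exists2 z, U z &
    rho (y (x + iota h *: e + iota h *: e') - y (x + iota h *: e)
         - (y (x + iota h *: e') - y x))
    = h * (h * rho ('D_e' ('D_e y) z)).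
Proof.
move=> h0 inU dU.
have dy s t sI tI := (dU _ (inU s t sI tI)).1.
have ddy s t sI tI := (dU _ (inU s t sI tI)).2.
have I0 : 0 \in `[0, h] by rewrite in_itv /= lexx.
have Ih : h \in `[0, h] by rewrite in_itv /= lexx andbT.
pose w z := y (z + iota h *: e') - y z.
have dy0 (s : R) : s \in `[0, h] -> derivable y (x + iota s *: e) e.
  by move=> sI; have := dy _ _ sI I0; rewrite rmorph0 scale0r addr0.
have dyh (s : R) : s \in `[0, h] ->
    derivable (fun z => y (z + iota h *: e')) (x + iota s *: e) e.
  by move=> sI; rewrite derivable_translate; exact: dy.
have [s sI|s sI mv1] := mean_value_along iota_cont rho_cont rhoZ
    (y := w) (a := x) (e := e) h0.
  by apply: derivableB; [exact: dyh | exact: dy0].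
have [t tI|t tI mv2] := mean_value_along iota_cont rho_cont rhoZ
    (y := 'D_e y) (a := x + iota s *: e) (e := e') h0; first exact: ddy.
exists (x + iota s *: e + iota t *: e'); first exact: inU.
rewrite -mv2 mv1; congr (_ * rho _).
rewrite deriveB; [|exact: dyh|exact: dy0].
by rewrite derive_translate.
Qed.

Lemma near_plane (R : realType) (F : numFieldType)
    (iota : {rmorphism R -> F}) (iota_cont : continuous iota)
    (n : nat) (x e e' : 'rV[F]_n) (U : set 'rV[F]_n) :
  nbhs x U -> exists2 d : R, 0 < d & forall s t : R,
    `|s| < d -> `|t| < d -> U (x + iota s *: e + iota t *: e').
Proof.
have cplane : (fun p : R * R => x + iota p.1 *: e + iota p.2 *: e')
    @ (0, 0) --> x.
  have -> : nbhs x = nbhs (x + iota (0 : R) *: e + iota (0 : R) *: e').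
    by rewrite rmorph0 !scale0r !addr0.
  apply: cvgD; last first.
    apply: cvgZr_tmp; apply: (@cvg_comp _ _ _ snd iota _ _ _ _ (iota_cont 0)).
    exact: cvg_snd.
  apply: cvgD; first exact: cvg_cst.
  apply: cvgZr_tmp; apply: (@cvg_comp _ _ _ fst iota _ _ _ _ (iota_cont 0)).
  exact: cvg_fst.
move=> /cplane; rewrite nbhs_simpl /= => /nbhs_ballP[d /= d0 dU].
exists d => // s t sd td; apply: (dU (s, t)).
by split; rewrite /ball /= sub0r normrN.
Qed.

(** The second difference is symmetric in [e] and [e'], so a value of one
    mixed derivative near [x] equals, after [rho], a value of the other; the
    two derivatives being continuous at [x], their values at [x] agree up to an
    arbitrarily small error. *)
Lemma derive_swap_real_part (R : realType) (F : numFieldType)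
    (iota : {rmorphism R -> F}) (rho : {additive F -> R})
    (iota_cont : continuous iota) (rho_cont : continuous rho)
    (rhoZ : forall r z, rho (iota r * z) = r * rho z)
    (n : nat) (y : 'rV[F]_n -> F) (x e e' : 'rV[F]_n) :
  (\forall z \near x, [/\ derivable y z e, derivable y z e',
      derivable ('D_e y) z e' & derivable ('D_e' y) z e]) ->
  {for x, continuous ('D_e' ('D_e y))} ->
  {for x, continuous ('D_e ('D_e' y))} ->
  rho ('D_e' ('D_e y) x) = rho ('D_e ('D_e' y) x).
Proof.
move=> dy cu cv; set u := 'D_e' _ in cu *; set v := 'D_e _ in cv *.
apply/eqP; rewrite -subr_eq0 -normr_le0; apply/ler_addgt0Pr => eps eps0.
have eps20 : 0 < eps / 2 by rewrite divr_gt0.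
have rho_u : rho (u z) @[z --> x] --> rho (u x).
  exact: cvg_comp _ _ cu (@rho_cont _).
have near_u : \forall z \near x, `|rho (u x) - rho (u z)| <= eps / 2.
  by move/cvgrPdist_le: rho_u; apply.
have rho_v : rho (v z) @[z --> x] --> rho (v x).
  exact: cvg_comp _ _ cv (@rho_cont _).
have near_v : \forall z \near x, `|rho (v x) - rho (v z)| <= eps / 2.
  by move/cvgrPdist_le: rho_v; apply.
have [d d0 box] :=
  near_plane iota_cont e e' (filterI (filterI dy near_u) near_v).
pose h := d / 2; have h0 : 0 < h by rewrite divr_gt0.
pose U := [set z | ([/\ derivable y z e, derivable y z e',
    derivable ('D_e y) z e' & derivable ('D_e' y) z e] /\
  `|rho (u x) - rho (u z)| <= eps / 2) /\ `|rho (v x) - rho (v z)| <= eps / 2].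
have inU (s t : R) : s \in `[0, h] -> t \in `[0, h] ->
    U (x + iota s *: e + iota t *: e').
  have small (r : R) : r \in `[0, h] -> `|r| < d.
    rewrite in_itv /= => /andP[r0 rh]; rewrite ger0_norm //.
    by apply: le_lt_trans rh _; rewrite ltr_pdivrMr // ltr_pMr // ltr1n.
  by move=> /small sd /small td; exact: box.
have inU' (s t : R) : s \in `[0, h] -> t \in `[0, h] ->
    U (x + iota s *: e' + iota t *: e).
  by move=> sI tI; rewrite addrAC; exact: inU.
have [|p [[_ up] _] D1] := second_difference iota_cont rho_cont rhoZ
    (ltW h0) inU (y := y); first by move=> z [[[]]].
have [|q [_ vq] D2] := second_difference iota_cont rho_cont rhoZ
    (ltW h0) inU' (y := y); first by move=> z [[[]]].
(* The second difference is the same in the two orders. *)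
have swapE (a b c k : F) : a - b - (c - k) = a - c - (b - k).
  by rewrite !opprB addrACA [RHS]addrACA [- b - c]addrC.
rewrite [x + iota h *: e' + _]addrAC swapE in D2.
have uv : h * (h * rho (u p)) = h * (h * rho (v q)) := etrans (esym D1) D2.
have {}uv : rho (u p) = rho (v q).
  exact: (mulfI (lt0r_neq0 h0) (mulfI (lt0r_neq0 h0) uv)).
have close (a b c c' k : R) : `|a - c| <= k -> `|b - c'| <= k -> c = c' ->
    `|a - b| <= k + k.
  move=> ac bc' cc'; apply: le_trans (ler_distD c a b) _.
  by apply: lerD; [exact: ac | rewrite distrC cc'; exact: bc'].
by rewrite add0r (splitr eps); exact: close up vq uv.
Qed.

Lemma near_dist_le (K : numFieldType) (z eps : K) :
  0 < eps -> \forall w \near z, `|z - w| <= eps.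
Proof. by move=> eps0; apply/nbhs_ballP; exists eps => // w /ltW. Qed.

(** A complex number is determined by its real and imaginary parts, and
    both are continuous and real-linear. *)
Lemma derive_swap (R : realType) (F : numFieldType)
    (hF : F = R :> numFieldType \/ F = R[i] :> numFieldType)
    (n : nat) (y : 'rV[F]_n -> F) (x e e' : 'rV[F]_n) :
  (\forall z \near x, [/\ derivable y z e, derivable y z e',
      derivable ('D_e y) z e' & derivable ('D_e' y) z e]) ->
  {for x, continuous ('D_e' ('D_e y))} ->
  {for x, continuous ('D_e ('D_e' y))} ->
  'D_e' ('D_e y) x = 'D_e ('D_e' y) x.
Proof.
case: hF => hF; subst F => dy cu cv.
  apply: (@derive_swap_real_part R R idfun idfun _ _ _ n y x e e' dy cu cv).
  - by move=> r; exact: cvg_id.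
  - by move=> r; exact: cvg_id.
  - by [].
have iota_cont : continuous (real_complex R : R -> (R[i] : numFieldType)).
  move=> r; apply/(@cvgrPdist_le _ R[i]^o) => eps eps0.
  move: (eps0); rewrite ltcE /= => /andP[/eqP im0 re0].
  apply: filterS (near_dist_le r re0) => s rs.
  rewrite -raddfB normc_def /= expr0n /= addr0 sqrtr_sqr.
  by rewrite lecE /= im0 eqxx.
have norm_part (z : R[i]) :
    `|complex.Re z|%:C <= `|z| /\ `|complex.Im z|%:C <= `|z|.
  by rewrite normc_def !lecR -!sqrtr_sqr !ler_wsqrtr// ?lerDl ?lerDr ?sqr_ge0.
have part_cont (rho : {additive R[i] -> R}) :
    (forall z, `|rho z|%:C <= `|z|) ->
    continuous (rho : (R[i] : numFieldType) -> R).
  move=> rho_le z.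
  apply/(cvgrPdist_le (F := nbhs (z : (R[i] : numFieldType)))) => eps eps0.
  have epsC0 : 0 < eps%:C by rewrite ltcR.
  apply: filterS (near_dist_le (K := R[i]) z epsC0) => w zw.
  by rewrite -raddfB -lecR; exact: le_trans (rho_le _) zw.
have partZ (r : R) (z : R[i]) : complex.Re (r%:C * z) = r * complex.Re z /\
     complex.Im (r%:C * z) = r * complex.Im z.
  by case: z => a b /=; rewrite !mul0r subr0 addr0.
apply/eqP; rewrite eq_complex; apply/andP; split; apply/eqP.
  apply: (derive_swap_real_part (iota := real_complex R) iota_cont
            (rho := @complex.Re R) _ _ dy cu cv).
  - by apply: part_cont => z; have [] := norm_part z.
  - by move=> r z; have [] := partZ r z.
apply: (derive_swap_real_part (iota := real_complex R) iota_cont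
            (rho := @complex.Im R) _ _ dy cu cv).
- by apply: part_cont => z; have [] := norm_part z.
- by move=> r z; have [] := partZ r z.
Qed.

(** * Functions of class C^k on an open set *)

Lemma near_eq_differentiable (K : numFieldType) (V W : normedModType K)
    (f g : V -> W) (x : V) :
  (\forall z \near x, f z = g z) -> differentiable f x -> differentiable g x.
Proof.
move=> fg /diff_locallyP[dfc /eqaddoP dfo].
have go : g \o shift x = cst (g x) + 'd f x +o_ (0 : V) id.
  apply/eqaddoP => eps eps0.
  have fg0 : \forall h \near (0 : V), f (h + x) = g (h + x).
    by move: fg; rewrite (near_shift 0) subr0.
  apply: filterS2 fg0 (dfo eps eps0) => h /= fgh.
  by rewrite /= !fctE /= fgh (nbhs_singleton fg).
have dgE : 'd g x = 'd f x :> (V -> W) by exact: diff_unique go.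
by apply/diff_locallyP; rewrite dgE.
Qed.

Section SmoothFunctions.
Variables (F : numFieldType) (n : nat) (Omega : set 'rV[F]_n).
Hypothesis Omega_open : open Omega.
Implicit Types (x v : 'rV[F]_n) (y z : 'rV[F]_n -> F) (s t : seq 'I_n).

Lemma near_eq_on y z x : (forall u, Omega u -> y u = z u) -> Omega x ->
  \forall u \near x, y u = z u.
Proof. by move=> yz Ox; apply: filterS yz _; exact: open_nbhs_nbhs. Qed.

Lemma derive_eq_on y z v : (forall x, Omega x -> y x = z x) ->
  forall x, Omega x -> 'D_v y x = 'D_v z x.
Proof. by move=> yz x Ox; apply: near_eq_derive; exact: near_eq_on. Qed.

(** Needed because the rules of differentiation identify derivatives at the
    points of [Omega] only. *)
Lemma Ck_on_eq k y z : (forall x, Omega x -> y x = z x) ->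
  Ck_on Omega k y -> Ck_on Omega k z.
Proof.
elim: k y z => [|k IH] y z yz => [cy x Ox|[dy Cy]].
  have near_yz : \forall u \near x, y u = z u by exact: near_eq_on.
  rewrite -yz //; exact: cvg_trans (near_eq_cvg near_yz) (cy x Ox).
split=> [x Ox|i].
  by apply: near_eq_differentiable (dy x Ox); exact: near_eq_on.
by apply: IH (Cy i); exact: derive_eq_on.
Qed.

Lemma Ck_onS k y : Ck_on Omega k.+1 y -> Ck_on Omega k y.
Proof.
elim: k y => [|k IH] y [dy Cy].
  by move=> x Ox; exact: differentiable_continuous (dy x Ox).
by split=> // i; exact: IH.
Qed.

Lemma Ck_on_le k l y : (k <= l)%N -> Ck_on Omega l y -> Ck_on Omega k y.
Proof.
move=> /subnK <-; elim: (l - k)%N => [//|d IH]; rewrite addSn => /Ck_onS.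
exact: IH.
Qed.

Lemma Ck_on_cst k (c : F) : Ck_on Omega k (fun=> c).
Proof.
elim: k c => [|k IH] c; first by move=> x _; exact: cst_continuous.
split=> [x _|i]; first exact: differentiable_cst.
by apply: Ck_on_eq (IH 0) => x _; rewrite derive_cst.
Qed.

Lemma derive_lincomb (c : F) y z v x : differentiable y x ->
  differentiable z x ->
  'D_v (fun u => c * y u + z u) x = c * 'D_v y x + 'D_v z x.
Proof.
move=> dy dz; have := @deriveD F _ _ (c \*: y) z x v.
rewrite deriveZ; last exact: diff_derivable.
by apply; [apply: derivableZ|]; exact: diff_derivable.
Qed.

Lemma Ck_on_lincomb k (c : F) y z : Ck_on Omega k y -> Ck_on Omega k z ->
  Ck_on Omega k (fun u => c * y u + z u).
Proof.
elim: k y z => [|k IH] y z => [cy cz x Ox|[dy Cy] [dz Cz]].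
  by apply: cvgD (cz x Ox); apply: cvgZl_tmp; exact: cy.
split=> [x Ox|i].
  apply: (@differentiableD _ _ _ (c \*: y) z); last exact: dz.
  by apply: differentiableZ; exact: dy.
apply: Ck_on_eq (IH _ _ (Cy i) (Cz i)) => x Ox.
by rewrite derive_lincomb; [|exact: dy|exact: dz].
Qed.

Lemma Ck_on_sum (I : Type) (r : seq I) k (c : I -> F)
    (y : I -> 'rV[F]_n -> F) : (forall i, Ck_on Omega k (y i)) ->
  Ck_on Omega k (fun x => \sum_(i <- r) c i * y i x).
Proof.
move=> Cy; elim: r => [|i r IH].
  by apply: Ck_on_eq (Ck_on_cst k 0) => x _; rewrite big_nil.
apply: Ck_on_eq (Ck_on_lincomb (c i) (Cy i) IH) => x _.
by rewrite big_cons.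
Qed.

Lemma Ck_on_partial k s y : Ck_on Omega (size s + k) y ->
  Ck_on Omega k (partial_along s y).
Proof.
elim: s k => [//|i s IH] k; rewrite [size _]/= addSnnS => /IH[_].
exact.
Qed.

Lemma partial_along_eq_on s y z : (forall x, Omega x -> y x = z x) ->
  forall x, Omega x -> partial_along s y x = partial_along s z x.
Proof. by move=> yz; elim: s => [//|i s IH] /=; exact: derive_eq_on. Qed.

Lemma partial_along_lincomb s (c : F) y z :
  Ck_on Omega (size s) y -> Ck_on Omega (size s) z ->
  forall x, Omega x -> partial_along s (fun u => c * y u + z u) x =
    c * partial_along s y x + partial_along s z x.
Proof.
elim: s => [//|i s IH] Cy Cz x Ox.
have C1 u : Ck_on Omega (size (i :: s)) u ->
    differentiable (partial_along s u) x.
  by move=> Cu; apply: (Ck_on_partial (k := 1) _).1; rewrite ?addn1.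
rewrite /= -[RHS]derive_lincomb; [|exact: C1|exact: C1].
by apply: derive_eq_on => //; apply: IH; exact: Ck_onS.
Qed.

Lemma partial_along_zero s :
  partial_along s (fun=> 0) = (fun=> 0) :> ('rV[F]_n -> F).
Proof.
by elim: s => [//|i s IH]; apply/funext => x /=; rewrite IH derive_cst.
Qed.

Lemma partial_along_sum (I : Type) (r : seq I) s (c : I -> F)
    (y : I -> 'rV[F]_n -> F) : (forall i, Ck_on Omega (size s) (y i)) ->
  forall x, Omega x -> partial_along s (fun u => \sum_(i <- r) c i * y i u) x =
    \sum_(i <- r) c i * partial_along s (y i) x.
Proof.
move=> Cy x Ox; elim: r => [|i r IH].
  rewrite big_nil (@partial_along_eq_on s _ (fun=> 0)) ?partial_along_zero //.
  by move=> u _; rewrite big_nil.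
rewrite big_cons -IH -partial_along_lincomb //; last exact: Ck_on_sum.
by apply: partial_along_eq_on => // u _; rewrite big_cons.
Qed.

End SmoothFunctions.

(** * Pullback by a linear map *)

Section Pullback.
Variables (F : numFieldType) (n : nat) (Omega : set 'rV[F]_n).
Variable A : {linear 'rV[F]_n -> 'rV[F]_n}.
Hypothesis Omega_open : open Omega.
Hypothesis A_Omega : forall x, Omega x -> Omega (A x).
Implicit Types (x v : 'rV[F]_n) (y z : 'rV[F]_n -> F).

Lemma linear_row_sum x : A x = \sum_j x 0 j *: A (delta_mx 0 j).
Proof.
by rewrite {1}[x]row_sum_delta linear_sum; under eq_bigr do rewrite linearZ.
Qed.

Lemma linear_row_differentiable x : differentiable A x.
Proof.
have -> : (A : 'rV[F]_n -> 'rV[F]_n) =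
    \sum_j (fun u : 'rV[F]_n => u 0 j *: A (delta_mx 0 j)).
  by apply/funext => u; rewrite fct_sumE linear_row_sum.
apply: differentiable_sum => j; apply: differentiableZl.
exact: differentiable_coord.
Qed.

(** An equality of difference quotients, hence valid without differentiability. *)
Lemma derive_pullback y v x : 'D_v (pullback A y) x = 'D_(A v) y (A x).
Proof.
rewrite /derive; have -> // : (fun h : F =>
    h^-1 *: ((pullback A y \o shift x) (h *: v) - pullback A y x)) =
  (fun h : F => h^-1 *: ((y \o shift (A x)) (h *: A v) - y (A x))).
by apply/funext => h; rewrite /pullback /= linearP.
Qed.

Lemma derive_coord y v x : differentiable y x ->
  'D_v y x = \sum_j v 0 j * 'D_(delta_mx 0 j) y x.
Proof.
move=> dy; rewrite deriveE // {1}[v]row_sum_delta linear_sum.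
by apply: eq_bigr => j _; rewrite linearZ deriveE.
Qed.

(** The partial derivatives of [y o A] are linear combinations, with
    coefficients from the matrix of [A], of the pullbacks of those of [y]. *)
Lemma Ck_on_pullback k y : Ck_on Omega k y -> Ck_on Omega k (pullback A y).
Proof.
elim: k y => [|k IH] y => [cy x Ox|[dy Cy]].
  apply: cvg_comp (cy _ (A_Omega Ox)).
  exact: differentiable_continuous (linear_row_differentiable x).
split=> [x Ox|i].
  exact: differentiable_comp (linear_row_differentiable x) (dy _ (A_Omega Ox)).
apply: (Ck_on_eq Omega_open) (Ck_on_sum Omega_open (index_enum _)
  (fun j => A (delta_mx 0 i) 0 j) (fun j => IH _ (Cy j))) => x Ox.
by rewrite derive_pullback derive_coord //; exact/dy/A_Omega.
Qed.

Lemma sum_tuple_cons k (G : k.+1.-tuple 'I_n -> F) :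
  \sum_J G J = \sum_j \sum_(J : k.-tuple 'I_n) G [tuple of j :: J].
Proof.
rewrite pair_big /=.
rewrite (reindex (fun p : 'I_n * k.-tuple 'I_n => [tuple of p.1 :: p.2])) //=.
exists (fun J => (thead J, [tuple of behead J])) => [[j J] _|J _] /=.
  by congr (_, _); apply: val_inj.
by rewrite -tuple_eta.
Qed.

(** Each differentiation contributes one matrix entry of [A] and one more
    index to sum over; these products are the coefficients in [tensor_act]. *)
Lemma partial_along_pullback k (I : k.-tuple 'I_n) y : Ck_on Omega k y ->
  forall x, Omega x -> partial_along I (pullback A y) x =
    \sum_(J : k.-tuple 'I_n)
      (\prod_(l < k) A (delta_mx 0 (tnth I l)) 0 (tnth J l)) *
      partial_along J y (A x).
Proof.
elim: k I => [|k IH] I Cy x Ox.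
  rewrite (big_pred1 I) => [|J]; last by rewrite /= (tuple0 J) (tuple0 I) eqxx.
  by rewrite big_ord0 mul1r (tuple0 I).
case/tupleP: I => i I; rewrite /= sum_tuple_cons exchange_big /=.
(* The last derivative acts on derivatives of order [k], of class [C^1]. *)
have CJ (J : k.-tuple 'I_n) : Ck_on Omega 1 (partial_along J y).
  by apply: Ck_on_partial; rewrite size_tuple addn1.
pose c (J : k.-tuple 'I_n) :=
  \prod_(l < k) A (delta_mx 0 (tnth I l)) 0 (tnth J l).
rewrite (derive_eq_on Omega_open (z := fun u =>
    \sum_(J : k.-tuple 'I_n) c J * pullback A (partial_along J y) u)) //; last first.
  by move=> u Ou; apply: IH => //; exact: Ck_onS.
have CAJ (J : k.-tuple 'I_n) : Ck_on Omega 1 (pullback A (partial_along J y)).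
  by apply: Ck_on_pullback; exact: CJ.
rewrite [LHS](partial_along_sum Omega_open _ (s := [:: i]) c CAJ Ox).
apply: eq_bigr => J _ /=; rewrite derive_pullback derive_coord; last first.
  by have [dJ _] := CJ J; exact/dJ/A_Omega.
rewrite big_distrr; apply: eq_bigr => j _ /=.
rewrite big_ord_recl !tnth0 mulrA [c J * _]mulrC; congr (_ * _ * _).
by apply: eq_bigr => l _; rewrite !tnthS.
Qed.

Lemma tensor_diff_pullback k (w : tensor F n k) y : Ck_on Omega k y ->
  forall x, Omega x ->
  tensor_diff w (pullback A y) x = tensor_diff (tensor_act A w) y (A x).
Proof.
move=> Cy x Ox; rewrite /tensor_diff.
under eq_bigr => I _.
  by rewrite partial_along_pullback // big_distrr; over.
rewrite exchange_big; apply: eq_bigr => J _; rewrite ffunE big_distrl /=.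
by apply: eq_bigr => I _; rewrite mulrA [w I * _]mulrC.
Qed.

End Pullback.

(** * Reordering partial derivatives *)

Section MixedPartials.
Variables (R : realType) (F : numFieldType).
Hypothesis hF : F = R :> numFieldType \/ F = R[i] :> numFieldType.
Variables (n : nat) (Omega : set 'rV[F]_n).
Hypothesis Omega_open : open Omega.
Implicit Types (x : 'rV[F]_n) (y : 'rV[F]_n -> F) (s t : seq 'I_n).

Lemma partial_swap y i j x : Ck_on Omega 2 y -> Omega x ->
  partial_along [:: i; j] y x = partial_along [:: j; i] y x.
Proof.
move=> [dy Cy] Ox; apply: (derive_swap hF).
- apply: (@filterS _ _ _ Omega); last exact: open_nbhs_nbhs.
  by move=> z Oz; split; apply: diff_derivable;
    [exact: dy|exact: dy|exact: (Cy j).1|exact: (Cy i).1].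
- exact: (Cy j).2.
- exact: (Cy i).2.
Qed.

(** An index is brought to the front by adjacent exchanges. *)
Lemma partial_along_move s1 s2 i y x : Ck_on Omega (size (s1 ++ i :: s2)) y ->
  Omega x ->
  partial_along (s1 ++ i :: s2) y x = partial_along (i :: s1 ++ s2) y x.
Proof.
elim: s1 x => [//|a s1 IH] x Cy Ox.
have IHO u : Omega u ->
    partial_along (s1 ++ i :: s2) y u = partial_along (i :: s1 ++ s2) y u.
  by move=> Ou; apply: IH => //; exact: Ck_onS.
apply: etrans (derive_eq_on Omega_open _ IHO Ox) _.
apply: (partial_swap (y := partial_along (s1 ++ s2) y)) => //.
apply: Ck_on_partial; move: Cy.
by rewrite cat_cons [size _]/= !size_cat addn2 /= addnS.
Qed.

Lemma partial_along_perm s t y x : perm_eq s t -> Ck_on Omega (size s) y ->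
  Omega x -> partial_along s y x = partial_along t y x.
Proof.
elim: s t x => [|i s IH] t x st Cy Ox.
  by move: st; rewrite perm_sym => /perm_nilP ->.
have : i \in t by rewrite -(perm_mem st) mem_head.
move=> it; case/splitPr: it st => t1 t2 st.
rewrite partial_along_move //; last by rewrite -(perm_size st).
apply: (derive_eq_on Omega_open) => // u Ou; apply: IH => //.
  by rewrite -(perm_cons i) (perm_trans st) // perm_catC /= perm_cons perm_catC.
exact: Ck_onS.
Qed.

End MixedPartials.

(** * Operators with constant coefficients *)

Section ConstantCoefficientOperators.
Variables (R : realType) (F : numFieldType).
Hypothesis hF : F = R :> numFieldType \/ F = R[i] :> numFieldType.
Variables (n : nat) (Omega : set 'rV[F]_n).
Hypothesis Omega_open : open Omega.
Implicit Types (x : 'rV[F]_n) (y z : 'rV[F]_n -> F).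

(** Sums over an arbitrary finite type, so that an operator given by tensors
    of all orders up to [m] is a single sum, indexed by pairs of an order and a
    multi-index. *)
Definition diff_comb (T : finType) (c : T -> F) (s : T -> seq 'I_n)
    (y : 'rV[F]_n -> F) : 'rV[F]_n -> F :=
  fun x => \sum_p c p * partial_along (s p) y x.

Lemma Ck_on_diff_comb (T : finType) (c : T -> F) (s : T -> seq 'I_n) m k y :
  (forall p, (size (s p) <= m)%N) -> Ck_on Omega (m + k) y ->
  Ck_on Omega k (diff_comb c s y).
Proof.
move=> sm Cy; apply: Ck_on_sum => // p; apply: Ck_on_partial.
by apply: Ck_on_le Cy => //; rewrite leq_add2r.
Qed.

Lemma diff_comb_lincomb (T : finType) (c : T -> F) (s : T -> seq 'I_n) m
    (a : F) y z :
  (forall p, (size (s p) <= m)%N) -> Ck_on Omega m y -> Ck_on Omega m z ->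
  forall x, Omega x -> diff_comb c s (fun u => a * y u + z u) x =
    a * diff_comb c s y x + diff_comb c s z x.
Proof.
move=> sm Cy Cz x Ox; rewrite /diff_comb big_distrr -big_split.
apply: eq_bigr => p _ /=.
rewrite (partial_along_lincomb Omega_open (s := s p) _ _ _ Ox).
- by rewrite mulrDr mulrCA.
- exact: Ck_on_le Cy.
- exact: Ck_on_le Cz.
Qed.

Lemma diff_comb_comp (T T' : finType) (c : T -> F) (s : T -> seq 'I_n)
    (c' : T' -> F) (s' : T' -> seq 'I_n) m m' y :
  (forall p, (size (s p) <= m)%N) -> (forall q, (size (s' q) <= m')%N) ->
  Ck_on Omega (m + m') y -> forall x, Omega x ->
  diff_comb c s (diff_comb c' s' y) x =
    \sum_p \sum_q c p * c' q * partial_along (s p ++ s' q) y x.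
Proof.
move=> sm sm' Cy x Ox; apply: eq_bigr => p _.
rewrite (partial_along_sum Omega_open _ (s := s p) c' _ Ox); last first.
  move=> q; apply: Ck_on_partial; apply: Ck_on_le Cy => //.
  by rewrite addnC leq_add.
rewrite big_distrr; apply: eq_bigr => q _ /=.
by rewrite mulrA /partial_along foldr_cat.
Qed.

Lemma diff_combC (T T' : finType) (c : T -> F) (s : T -> seq 'I_n)
    (c' : T' -> F) (s' : T' -> seq 'I_n) m m' y :
  (forall p, (size (s p) <= m)%N) -> (forall q, (size (s' q) <= m')%N) ->
  Ck_on Omega (m + m') y -> forall x, Omega x ->
  diff_comb c s (diff_comb c' s' y) x = diff_comb c' s' (diff_comb c s y) x.
Proof.
move=> sm sm' Cy x Ox.
rewrite (diff_comb_comp c c' sm sm' Cy Ox).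
rewrite addnC in Cy; rewrite (diff_comb_comp c' c sm' sm Cy Ox).
rewrite exchange_big; apply: eq_bigr => q _; apply: eq_bigr => p _.
rewrite [c p * _]mulrC; congr (_ * _).
apply: (partial_along_perm hF Omega_open) => //; first by rewrite perm_catC.
by apply: Ck_on_le Cy => //; rewrite size_cat addnC leq_add.
Qed.

Lemma PD_on_eq r (T T' : ('rV[F]_n -> F) -> 'rV[F]_n -> F) :
  (forall y, Ck_on Omega r y -> forall x, Omega x -> T y x = T' y x) ->
  PD_on Omega r T -> PD_on Omega r T'.
Proof.
move=> TT' [zeta [sym_zeta zetaP]]; exists zeta; split=> // y Cy x Ox.
by rewrite -TT' // zetaP.
Qed.

Lemma PD_on_add r (T T' : ('rV[F]_n -> F) -> 'rV[F]_n -> F) :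
  PD_on Omega r T -> PD_on Omega r T' ->
  PD_on Omega r (fun y x => T y x + T' y x).
Proof.
move=> [zeta [sym_zeta zetaP]] [zeta' [sym_zeta' zetaP']].
exists (fun k => zeta k + zeta' k); split=> [k I J IJ|y Cy x Ox].
  by rewrite !ffunE (sym_zeta k I J IJ) (sym_zeta' k I J IJ).
rewrite zetaP // zetaP' // -big_split; apply: eq_bigr => k _.
rewrite /tensor_diff -big_split; apply: eq_bigr => I _.
by rewrite ffunE mulrDl.
Qed.

Lemma PD_on_sum r (I : Type) (l : seq I)
    (T : I -> ('rV[F]_n -> F) -> 'rV[F]_n -> F) :
  (forall i, PD_on Omega r (T i)) ->
  PD_on Omega r (fun y x => \sum_(i <- l) T i y x).
Proof.
move=> PT; elim: l => [|i l IH].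
  exists (fun k => [ffun=> 0]); split=> [k I0 J _|y Cy x Ox].
    by rewrite !ffunE.
  rewrite big_nil big1 // => k _; apply: big1 => J _.
  by rewrite ffunE mul0r.
by apply: PD_on_eq (PD_on_add (PT i) IH) => y _ x _; rewrite big_cons.
Qed.

(** The symmetric tensor has the coefficient [c / N] at each of the [N]
    reorderings of [s]; by symmetry of mixed derivatives all of them act as
    [s]. *)
Lemma PD_on_monomial r (c : F) (s : seq 'I_n) : (size s <= r)%N ->
  PD_on Omega r (fun y x => c * partial_along s y x).
Proof.
move=> sr; pose orbit k := [set K : k.-tuple 'I_n | perm_eq K s]%SET.
exists (fun k => [ffun K => if K \in orbit k then c / #|orbit k|%:R else 0]).
split=> [k I J IJ|y Cy x Ox].
  by rewrite !ffunE !inE (permPl IJ).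
rewrite (bigD1 (Ordinal (sr : (size s < r.+1)%N))) //= [X in _ + X]big1 => [|k].
  rewrite addr0 /tensor_diff (bigID (mem (orbit (size s)))) /=.
  rewrite [X in _ + X]big1 => [|K /negbTE sK]; last by rewrite ffunE sK mul0r.
  rewrite addr0 (eq_bigr (fun=> c / #|orbit (size s)|%:R * partial_along s y x)).
    rewrite sumr_const -mulrnAl -mulr_natr divfK // pnatr_eq0 -lt0n.
    by apply/card_gt0P; exists (in_tuple s); rewrite inE.
  move=> K sK; rewrite ffunE sK; congr (_ * _).
  apply: (partial_along_perm hF Omega_open) => //; first by rewrite inE in sK.
  by apply: Ck_on_le Cy => //; rewrite size_tuple.
move=> ks; apply: big1 => K _; rewrite ffunE inE; case: ifP => [sK|_]; last first.
  by rewrite mul0r.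
by case/eqP: ks; apply: val_inj; rewrite /= -(perm_size sK) size_tuple.
Qed.

Lemma PD_on_diff_comb_comp (T T' : finType) (c : T -> F) (s : T -> seq 'I_n)
    (c' : T' -> F) (s' : T' -> seq 'I_n) m m' :
  (forall p, (size (s p) <= m)%N) -> (forall q, (size (s' q) <= m')%N) ->
  PD_on Omega (m + m') (fun y => diff_comb c s (diff_comb c' s' y)).
Proof.
move=> sm sm'; apply: (@PD_on_eq _ (fun y x =>
    \sum_p \sum_q c p * c' q * partial_along (s p ++ s' q) y x)).
  by move=> y Cy x Ox; rewrite (diff_comb_comp c c' sm sm' Cy Ox).
apply: PD_on_sum => p; apply: PD_on_sum => q; apply: PD_on_monomial.
by rewrite size_cat leq_add.
Qed.

End ConstantCoefficientOperators.

(** * Operators given by tensors, and their products with the pullback *)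

Section TensorOperators.
Variables (F : numFieldType) (n m : nat).
Implicit Types (w : forall k : 'I_m.+1, tensor F n k).

Definition total_coef w (p : {k : 'I_m.+1 & k.-tuple 'I_n}) : F :=
  w (tag p) (tagged p).

Definition total_index (p : {k : 'I_m.+1 & k.-tuple 'I_n}) : seq 'I_n :=
  tagged p.

Definition total_diff w := diff_comb (total_coef w) total_index.

Lemma total_diffE w y x :
  total_diff w y x = \sum_(k < m.+1) tensor_diff (w k) y x.
Proof. by rewrite /tensor_diff sig_big_dep. Qed.

Lemma size_total_index p : (size (total_index p) <= m)%N.
Proof. by rewrite size_tuple -ltnS. Qed.

Variables (Omega : set 'rV[F]_n) (A : {linear 'rV[F]_n -> 'rV[F]_n}).
Hypothesis Omega_open : open Omega.
Hypothesis A_Omega : forall x, Omega x -> Omega (A x).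

Lemma total_diff_pullback w y : Ck_on Omega m y -> forall x, Omega x ->
  total_diff w (pullback A y) x =
  total_diff (fun k => tensor_act A (w k)) y (A x).
Proof.
move=> Cy x Ox; rewrite !total_diffE; apply: eq_bigr => k _.
apply: tensor_diff_pullback Ox => //.
by apply: Ck_on_le Cy => //; rewrite -ltnS.
Qed.

(** The factor [1] puts the sum in the form of [diff_comb_lincomb]. *)
Lemma inv_opE (w : forall (j : 'I_2) (k : 'I_m.+1), tensor F n k) y :
  inv_op A w y = (fun x => 1 * total_diff (w ord0) y x
                             + pullback A (total_diff (w ord_max) y) x).
Proof.
apply/funext => x; rewrite /inv_op big_ord_recl big_ord1 mul1r.
rewrite (_ : lift ord0 ord0 = ord_max); last exact: val_inj.
by rewrite /pullback !total_diffE.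
Qed.

Lemma Ck_on_total_diff w k y : Ck_on Omega (m + k) y ->
  Ck_on Omega k (total_diff w y).
Proof. exact: (Ck_on_diff_comb Omega_open _ size_total_index). Qed.

(** Expansion of a product of two operators into its part without the pullback
    and its part with it, once [A^*] has been moved to the left and cancelled
    against itself. *)
Lemma inv_op_comp (w w' : forall (j : 'I_2) (k : 'I_m.+1), tensor F n k) y x :
  (forall u, A (A u) = u) -> Ck_on Omega (m + m) y -> Omega x ->
  inv_op A w (inv_op A w' y) x =
    (total_diff (w ord0) (total_diff (w' ord0) y) x +
     total_diff (fun k => tensor_act A (w ord_max k))
       (total_diff (w' ord_max) y) x) +
    (total_diff (fun k => tensor_act A (w ord0 k))
       (total_diff (w' ord_max) y) (A x) +
     total_diff (w ord_max) (total_diff (w' ord0) y) (A x)).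
Proof.
move=> AK Cy Ox; have AOx := A_Omega Ox.
have C0 := Ck_on_total_diff (w' ord0) Cy.
have C1 := Ck_on_total_diff (w' ord_max) Cy.
have CA1 := Ck_on_pullback Omega_open A_Omega C1.
have lin v u : Omega u -> total_diff v (fun u => 1 * total_diff (w' ord0) y u
      + pullback A (total_diff (w' ord_max) y) u) u =
    1 * total_diff v (total_diff (w' ord0) y) u
      + total_diff v (pullback A (total_diff (w' ord_max) y)) u.
  exact: (diff_comb_lincomb Omega_open _ 1 size_total_index C0 CA1).
rewrite !inv_opE /pullback -/(pullback A _) !lin // !mul1r.
rewrite !total_diff_pullback // AK -!addrA; congr (_ + _).
by rewrite addrA [RHS]addrC.
Qed.

End TensorOperators.

(** * Commutation of the two operators *)

Theorem theorem3p3 (R : realType) (F : numFieldType)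
    (hF : F = R :> numFieldType \/ F = R[i] :> numFieldType)
    (n : nat) (A : {linear 'rV[F]_n -> 'rV[F]_n})
    (hA2 : forall x, A (A x) = x) (hA1 : ~ (forall x, A x = x))
    (Omega : set 'rV[F]_n) (hopen : open Omega) (hconn : connected Omega)
    (hAOmega : A @` Omega = Omega)
    (m : nat) (omega xi : forall (j : 'I_2) (k : 'I_m.+1), tensor F n k)
    (homega : forall j k, symmetric_tensor (omega j k))
    (hxi0 : forall k, xi ord0 k = - tensor_act A (omega ord0 k))
    (hxi1 : forall k, xi ord_max k = omega ord_max k) :
  let Lop := inv_op A omega in
  let Rop := inv_op A xi in
  PD_on Omega (2 * m) (fun y => Rop (Lop y)) /\
  (forall y, Ck_on Omega (2 * m) y ->
     forall x, Omega x -> Rop (Lop y) x = Lop (Rop y) x).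
Proof.
move=> Lop Rop.
have A_Omega x : Omega x -> Omega (A x) by move=> Ox; rewrite -hAOmega; exists x.
have sm := @size_total_index n m.
pose P0 := total_diff (omega ord0); pose P1 := total_diff (omega ord_max).
pose B0 := total_diff (fun k => tensor_act A (omega ord0 k)).
pose B1 := total_diff (fun k => tensor_act A (omega ord_max k)).
pose Q0 := total_diff (xi ord0).
have Q1E : xi ord_max = omega ord_max by apply: functional_extensionality_dep.
have Q0E y x : Q0 y x = - B0 y x.
  rewrite /Q0 /B0 !total_diffE -sumrN; apply: eq_bigr => k _.
  rewrite hxi0 /tensor_diff -sumrN.
  by apply: eq_bigr => I _; rewrite [in LHS]ffunE mulNr.
(* As [A] is an involution, twisting the coefficients twice gives them back;
   this is read off from the action on functions. *)
have B0A z x : Ck_on Omega m z -> Omega x -> B0 (pullback A z) x = P0 z (A x).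
  move=> Cz Ox; have CAz := Ck_on_pullback hopen A_Omega Cz.
  have {2}<- : pullback A (pullback A z) = z.
    by apply/funext => u; rewrite /pullback hA2.
  rewrite /P0 (total_diff_pullback hopen A_Omega _ CAz) ?hA2 //.
  exact: A_Omega.
have AQ0 z x : Ck_on Omega m z -> Omega x ->
    total_diff (fun k => tensor_act A (xi ord0 k)) z (A x) = - P0 z (A x).
  move=> Cz Ox; rewrite -(total_diff_pullback hopen A_Omega _ Cz Ox).
  by rewrite -/Q0 Q0E B0A.
have comm (w w' : forall k : 'I_m.+1, tensor F n k) y x :
    Ck_on Omega (m + m) y -> Omega x ->
    total_diff w (total_diff w' y) x = total_diff w' (total_diff w y) x.
  by move=> Cy Ox; exact: (diff_combC hF hopen _ _ sm sm Cy Ox).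
have RL y x : Ck_on Omega (m + m) y -> Omega x ->
    Rop (Lop y) x = Q0 (P0 y) x + B1 (P1 y) x.
  move=> Cy Ox; have AOx := A_Omega x Ox.
  rewrite /Rop /Lop (inv_op_comp hopen A_Omega _ _ hA2 Cy Ox) Q1E.
  rewrite AQ0 //; last exact: Ck_on_total_diff.
  by rewrite -[X in _ + (_ + X)]comm // addNr addr0.
have LR y x : Ck_on Omega (m + m) y -> Omega x ->
    Lop (Rop y) x = P0 (Q0 y) x + B1 (P1 y) x.
  move=> Cy Ox; have AOx := A_Omega x Ox.
  rewrite /Rop /Lop (inv_op_comp hopen A_Omega _ _ hA2 Cy Ox) Q1E.
  rewrite [X in _ + (_ + X)]comm // -/Q0 Q0E.
  by rewrite addrN addr0.
rewrite mul2n -addnn; split=> [|y Cy x Ox].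
  apply: (PD_on_eq (T := fun y x => Q0 (P0 y) x + B1 (P1 y) x)).
    by move=> y Cy x Ox; rewrite RL.
  by apply: PD_on_add; exact: (PD_on_diff_comb_comp hF hopen _ _ sm sm).
by rewrite RL // LR // /Q0 /P0 comm.
Qed.
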